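(* Let $n,p,k$ be positive integers with $k\le\min(n,p)$, $\lambda>0$, $\boldsymbol X\in\mathbb R^{n\times p}$, $\boldsymbol y\in\mathbb R^n$, and consider the problem $$v^{\mathbf{CVaR}}=\min_{\boldsymbol\beta\in\mathbb R^p}\left\{\frac1n\|\boldsymbol y-\boldsymbol X\boldsymbol\beta\|_2^2+\lambda\|\boldsymbol\beta\|_2^2:\ \inf_{t\in\mathbb R}\left[-\frac kp t+\frac1p\sum_{i\in[p]}(|\beta_i|+t)_+\right]\le 0\right\}.$$ The only feasible solution of this problem is $\boldsymbol\beta=0$; that is, $v^{\mathbf{CVaR}}=\frac1n\|\boldsymbol y\|_2^2$.
   Context: $[p]=\{1,\dots,p\}$ and $(w)_+=\max(w,0)$. The problem is the conditional-value-at-risk approximation of sparse ridge regression with at most $k$ nonzero coefficients. *)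

(* Defs.v *)
From HB Require Import structures.
From mathcomp Require Import all_boot all_order all_algebra.
From mathcomp Require Import all_classical all_reals all_analysis.

Set Implicit Arguments.
Unset Strict Implicit.
Unset Printing Implicit Defensive.

Import Order.TTheory GRing.Theory Num.Theory.

Local Open Scope classical_set_scope.
Local Open Scope ring_scope.

(* Square of the Euclidean norm; the canonical norm `|v| on matrices is the
   sup norm, hence the explicit sum. *)
Definition sqnorm2 (R : realType) (m : nat) (v : 'cV[R]_m) : R :=
  \sum_(i < m) v i 0 ^+ 2.

Definition ridge_obj (R : realType) (n p : nat) (lambda : R)
    (X : 'M[R]_(n, p)) (y : 'cV[R]_n) (beta : 'cV[R]_p) : R :=
  n%:R^-1 * sqnorm2 (y - X *m beta) + lambda * sqnorm2 beta.

Definition cvar_fun (R : realType) (p k : nat) (beta : 'cV[R]_p) (t : R) : R :=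
  - (k%:R / p%:R) * t + p%:R^-1 * \sum_(i < p) Num.max (`|beta i 0| + t) 0.

(* The infima are taken in \bar R, where they are genuine greatest lower bounds:
   on R, [inf] has a default value on sets that are empty or not bounded
   below. *)
Definition cvar_feasible (R : realType) (p k : nat) : set 'cV[R]_p :=
  [set beta | (ereal_inf (range (fun t : R => (cvar_fun k beta t)%:E)) <= 0)%E].

Arguments cvar_feasible : clear implicits.

Definition vCVaR (R : realType) (n p k : nat) (lambda : R)
    (X : 'M[R]_(n, p)) (y : 'cV[R]_n) : \bar R :=
  ereal_inf [set (ridge_obj lambda X y beta)%:E | beta in cvar_feasible R p k].

(* Main.v *)
(** The CVaR function dominates [`|beta i 0| / p] for every [i], uniformly
    in [t].  For [t < 0] keep only the [i]-th term and use [- k t >= - t],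
    which needs [k >= 1]; for [0 <= t] the sum is
    [\sum_j `|beta j 0| + p t], and [k <= p].  So a nonzero [beta] makes the
    infimum positive, whereas [t = 0] shows that [beta = 0] is feasible. *)

Require Import Defs.
From mathcomp Require Import all_boot all_order all_algebra.
From mathcomp Require Import all_classical all_reals all_analysis.
From mathcomp Require Import lra.

Import Order.TTheory GRing.Theory Num.Theory.

Local Open Scope classical_set_scope.
Local Open Scope ring_scope.

Lemma ler_bigsum_term (R : numDomainType) (I : finType) (F : I -> R) (i : I) :
  (forall j, 0 <= F j) -> F i <= \sum_j F j.
Proof. by move=> F_ge0; rewrite (bigD1 i) //= lerDl sumr_ge0. Qed.

Lemma cvar_fun_ge (R : realType) (p k : nat) (beta : 'cV[R]_p) (i : 'I_p)
    (t : R) : (0 < k <= p)%N -> p%:R^-1 * `|beta i 0| <= cvar_fun k beta t.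
Proof.
move=> /andP[k_gt0 k_le_p].
have k_ge1 : 1 <= k%:R :> R by rewrite ler1n.
have k_leR : k%:R <= p%:R :> R by rewrite ler_nat.
(* Factoring out [p%:R^-1] leaves a claim linear in [k%:R * t] and the sum, which [lra] can
   settle. *)
have -> : cvar_fun k beta t =
    p%:R^-1 * (- (k%:R * t) + \sum_(j < p) Num.max (`|beta j 0| + t) 0).
  by rewrite /cvar_fun mulrDr mulrN mulrA mulNr [p%:R^-1 * k%:R]mulrC.
rewrite ler_wpM2l ?invr_ge0 ?ler0n//.
have [t_ge0|t_lt0] := leP 0 t.
- have -> : \sum_(j < p) Num.max (`|beta j 0| + t) 0 =
      \sum_(j < p) `|beta j 0| + p%:R * t.
    under eq_bigr => j _ do rewrite max_l ?addr_ge0//.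
    by rewrite big_split /= sumr_const card_ord mulr_natl.
  have : `|beta i 0| <= \sum_(j < p) `|beta j 0|.
    exact: (@ler_bigsum_term _ _ (fun j => `|beta j 0|)).
  by have := ler_wpM2r t_ge0 k_leR; lra.
- have : Num.max (`|beta i 0| + t) 0 <=
      \sum_(j < p) Num.max (`|beta j 0| + t) 0.
    apply: (@ler_bigsum_term _ _ (fun j => Num.max (`|beta j 0| + t) 0)) => j.
    by rewrite le_max lexx orbT.
  have : `|beta i 0| + t <= Num.max (`|beta i 0| + t) 0.
    by rewrite le_max lexx.
  (* Multiplying [1 <= k] by the negative [t] reverses it: [k%:R * t <= t], which absorbs the [t] of
     the retained term. *)
  by have := ler_wnM2r (ltW t_lt0) k_ge1; lra.
Qed.

Lemma cvar_feasibleE (R : realType) (p k : nat) :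
  (0 < k <= p)%N -> cvar_feasible R p k = [set 0].
Proof.
move=> k_bounds.
have p_gt0 : (0 < p)%N by case/andP: k_bounds; exact: leq_trans.
apply/seteqP; split => [beta /= inf_le0|_ ->].
  apply/colP => i; rewrite mxE; apply/eqP; rewrite -normr_le0.
  (* Scaling by the positive [p%:R^-1] gives exactly the lower bound that is uniform in [t]; it
     passes to the infimum, whether or not the latter is attained. *)
  rewrite -(@pmulr_rle0 _ p%:R^-1) ?invr_gt0 ?ltr0n// -lee_fin.
  apply: le_trans inf_le0; apply/ereal_infP => _ [t _ <-].
  by rewrite lee_fin cvar_fun_ge.
apply: ge_ereal_inf; exists (cvar_fun k (0 : 'cV[R]_p) 0)%:E; first by exists 0.
rewrite lee_fin /cvar_fun mulr0 add0r big1 ?mulr0// => i _.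
by rewrite mxE normr0 addr0 maxxx.
Qed.

Theorem proposition1 (R : realType) (n p k : nat)
    (n_gt0 : (0 < n)%N) (p_gt0 : (0 < p)%N) (k_gt0 : (0 < k)%N)
    (k_le : (k <= minn n p)%N) (lambda : R) (lambda_gt0 : 0 < lambda)
    (X : 'M[R]_(n, p)) (y : 'cV[R]_n) :
  [/\ cvar_feasible R p k = [set 0],
      exists2 beta : 'cV[R]_p, cvar_feasible R p k beta &
        (ridge_obj lambda X y beta)%:E = vCVaR k lambda X y
    & vCVaR k lambda X y = (n%:R^-1 * sqnorm2 y)%:E].
Proof.
have feasE : cvar_feasible R p k = [set 0].
  by apply: cvar_feasibleE; move: k_le; rewrite k_gt0 leq_min => /andP[].
(* The infimum over a single point is the value there, so it is a finite minimum attained at [0]. *)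
have vE : vCVaR k lambda X y = (ridge_obj lambda X y 0)%:E.
  by rewrite /vCVaR feasE image_set1 ereal_inf1.
split => //; first by exists 0; rewrite ?feasE.
rewrite vE /ridge_obj mulmx0 subr0 [sqnorm2 0]big1 ?mulr0 ?addr0// => i _.
by rewrite mxE expr0n.
Qed.
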